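(* Let $n\in\mathcal{N}$ and $y,z\in\mathcal{X}$ such that $y\preceq\psi(n)\preceq z$. Let $t\in\mathbb{N}$ and $a_{-t+1},\dots,a_0\in\mathcal{E}$. Then for any $s\in\mathbb{N}$ with $s\le t$: $$\underline{H}\left([y,z],a_{-t+1\to-s}\right)\ \preceq\ \psi\big(X_{-s}(-t,n)\big)\ \preceq\ \overline{H}\left([y,z],a_{-t+1\to-s}\right).$$
   Context: Let $\mathcal{N}$ be a finite state space, $\mathcal{E}$ a set of events, and $g:\mathcal{N}\times\mathcal{E}\to\mathcal{N}$ a transition function. Let $(\mathcal{X},\preceq)$ be a finite lattice and $\psi:\mathcal{N}\to\mathcal{X}$ a projection (surjective map). For $m\preceq M$ in $\mathcal{X}$, $[m,M]=\{x\in\mathcal{X}:m\preceq x\preceq M\}$. For $x\in\mathcal{X}$ put $S_x=\psi^{-1}(\{x\})$, and for $a\in\mathcal{E}$ let $f(x,a)=\psi(g(S_x,a))=\{\psi(g(n,a)):n\in S_x\}\subset\mathcal{X}$, $g^{\inf}(x,a)=\inf f(x,a)$, $g^{\sup}(x,a)=\sup f(x,a)$. The aggregated envelope transition function is $$H([m,M],a)=\Big[\inf_{m\preceq x\preceq M}g^{\inf}(x,a),\ \sup_{m\preceq x\preceq M}g^{\sup}(x,a)\Big]=\big[\underline{H}([m,M],a),\overline{H}([m,M],a)\big].$$ It is extended to words of events by $H([m,M],\epsilon)=[m,M]$ for the empty word $\epsilon$ and $H([m,M],b_1\cdots b_k)=H(H([m,M],b_1\cdots b_{k-1}),b_k)$;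 $\underline{H}([m,M],w)$ and $\overline{H}([m,M],w)$ denote the lower and upper endpoints of $H([m,M],w)$ for a word $w$. For $0\le s\le t$, $a_{-t+1\to-s}$ denotes the word $a_{-t+1}a_{-t+2}\cdots a_{-s}$ (empty if $s=t$). $X_{-s}(-t,n)$ is the state at time $-s$ of the chain started from $n$ at time $-t$ and driven by these events: $X_{-t}(-t,n)=n$ and $X_{-s+1}(-t,n)=g(X_{-s}(-t,n),a_{-s+1})$ for $1\le s\le t$. *)

(* Defs.v *)
From HB Require Import structures.
From mathcomp Require Import all_boot all_order.

Set Implicit Arguments.
Unset Strict Implicit.
Unset Printing Implicit Defensive.

Import Order.TTheory.
Local Open Scope order_scope.

Section AggregatedEnvelope.

(* A nonempty finite lattice is a finTBLatticeType; psi : N -> X below makes X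
   nonempty as soon as N is. *)
Variables (N : finType) (E : Type) (d : Order.disp_t) (X : finTBLatticeType d).
Variables (g : N -> E -> N) (psi : N -> X).

Definition fiber (x : X) : {set N} := psi @^-1: [set x].

Definition image_set (x : X) (a : E) : {set X} := [set psi (g n a) | n in fiber x].

Definition ginf (x : X) (a : E) : X := \meet_(y in image_set x a) y.
Definition gsup (x : X) (a : E) : X := \join_(y in image_set x a) y.

(* The interval [m, M], m <= M, is encoded by its pair of endpoints (m, M);
   envelope_le shows that the image is again such a pair. *)
Definition envelope (I : X * X) (a : E) : X * X :=
  (\meet_(x | I.1 <= x <= I.2) ginf x a,
   \join_(x | I.1 <= x <= I.2) gsup x a).

Definition envelope_word (I : X * X) (w : seq E) : X * X := foldl envelope I w.

Definition Hlow (I : X * X) (w : seq E) : X := (envelope_word I w).1.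
Definition Hup (I : X * X) (w : seq E) : X := (envelope_word I w).2.

(* The events a_{-t+1}, ..., a_0 are listed in this order in the tuple a, so
   a_{-j} is tnth a (rev_ord j) for j : 'I_t, and a_{-t+1} ... a_{-s} consists
   of the first t - s letters. *)
Definition word_to (t : nat) (a : t.-tuple E) (s : nat) : seq E :=
  take (t - s)%N a.

(* X_{-s}(-t, n); see state_start and state_step for the recurrence. *)
Definition state (t : nat) (a : t.-tuple E) (n : N) (s : nat) : N :=
  foldl g n (word_to a s).

Lemma envelope_le (psi_surj : forall x, exists n, psi n = x) I a :
  I.1 <= I.2 -> (envelope I a).1 <= (envelope I a).2.
Proof.
move=> le12; have [n psin] := psi_surj I.1.
have inf1 : psi (g n a) \in image_set I.1 a.
  by apply: imset_f; rewrite !inE psin.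
have in1 : I.1 <= I.1 <= I.2 by rewrite lexx.
apply: le_trans (_ : psi (g n a) <= _).
  by apply: (meets_max (j := I.1)) => //; apply: meets_inf.
by apply: (joins_min (j := I.1)) => //; apply: joins_sup.
Qed.

Lemma envelope_word_nil I : envelope_word I [::] = I.
Proof. by []. Qed.

Lemma envelope_word_rcons I w b :
  envelope_word I (rcons w b) = envelope (envelope_word I w) b.
Proof. exact: foldl_rcons. Qed.

Lemma state_start t (a : t.-tuple E) n : state a n t = n.
Proof. by rewrite /state /word_to subnn take0. Qed.

Lemma word_to_step t (a : t.-tuple E) (j : 'I_t) :
  word_to a j = rcons (word_to a j.+1) (tnth a (rev_ord j)).
Proof.
rewrite /word_to (tnth_nth (tnth a j)) /= -take_nth subnSK //.
by rewrite size_tuple leq_subr.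
Qed.

Lemma state_step t (a : t.-tuple E) n (j : 'I_t) :
  state a n j = g (state a n j.+1) (tnth a (rev_ord j)).
Proof. by rewrite /state word_to_step foldl_rcons. Qed.

End AggregatedEnvelope.

(* Main.v *)
Require Import Defs.
From mathcomp Require Import all_boot all_order.

Import Order.TTheory.

(** Bracketing of [psi n] by the endpoints is an invariant of each event: [psi n] is one of the
    points over which the envelope takes its inf and sup, and [n] lies in its fiber. Induction on
    the word propagates this along the trajectory. *)

Lemma envelope_step (N : finType) (E : Type) (d : Order.disp_t)
    (X : finTBLatticeType d) (g : N -> E -> N) (psi : N -> X)
    (I : X * X) (n : N) (b : E) :
  (I.1 <= psi n <= I.2)%O ->
  ((envelope g psi I b).1 <= psi (g n b) <= (envelope g psi I b).2)%O.
Proof.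
move=> In.
have im : psi (g n b) \in image_set g psi (psi n) b.
  by apply: imset_f; rewrite !inE.
apply/andP; split.
  (* The outer meet is bounded by its term at [psi n], itself a meet over a set containing
     [psi (g n b)]. *)
  by apply: (meets_max (j := psi n)) => //; apply: meets_inf.
by apply: (joins_min (j := psi n)) => //; apply: joins_sup.
Qed.

Lemma envelope_word_foldl (N : finType) (E : Type) (d : Order.disp_t)
    (X : finTBLatticeType d) (g : N -> E -> N) (psi : N -> X)
    (w : seq E) (I : X * X) (n : N) :
  (I.1 <= psi n <= I.2)%O ->
  (Hlow g psi I w <= psi (foldl g n w) <= Hup g psi I w)%O.
Proof.
rewrite /Hlow /Hup /envelope_word.
(* Both folds consume [b] first, so [I] and [n] must vary in the induction. *)
elim: w I n => [|b w IHw] I n //= In.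
exact/IHw/envelope_step.
Qed.

Theorem proposition16 (N : finType) (E : Type) (d : Order.disp_t)
    (X : finTBLatticeType d) (g : N -> E -> N) (psi : N -> X)
    (psi_surj : forall x : X, exists n : N, psi n = x)
    (n : N) (y z : X) (hyz : (y <= psi n <= z)%O)
    (t : nat) (a : t.-tuple E) (s : nat) (hst : s <= t) :
  (Hlow g psi (y, z) (word_to a s) <= psi (state g a n s)
     <= Hup g psi (y, z) (word_to a s))%O.
(* [state a n s] unfolds to the fold of [g] over the same word [word_to a s]. *)
Proof. exact: envelope_word_foldl. Qed.
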